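(* Let $n,m,N$ be positive integers with $n>m$ and $\frac{n-1}{n-m}\leq N\leq m$. Then for almost all $\lambda_0\in\mathbb{C}^n$, almost all $X_0\in\mathbb{C}^{m\times N}$ and almost all $A\in\mathbb{C}^{n\times m}$ (i.e., for all $(\lambda_0,X_0,A)\in\mathbb{C}^n\times\mathbb{C}^{m\times N}\times\mathbb{C}^{n\times m}$ outside a set of Lebesgue measure zero), the pair $(\lambda_0,X_0)$ is identifiable up to scaling in the BGPC problem with a subspace constraint: whenever $\lambda\in\mathbb{C}^n$ and $X\in\mathbb{C}^{m\times N}$ satisfy $\operatorname{diag}(\lambda)AX=\operatorname{diag}(\lambda_0)AX_0$, there exists a nonzero $\sigma\in\mathbb{C}$ with $\lambda=\sigma\lambda_0$ and $X=\frac{1}{\sigma}X_0$.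
   Context: $\operatorname{diag}(\lambda)$ denotes the $n\times n$ diagonal matrix with the entries of $\lambda$ on its diagonal. The BGPC (blind gain and phase calibration) problem with a subspace constraint is: given $A$ and $Y=\operatorname{diag}(\lambda_0)AX_0$, find $(\lambda,X)\in\mathbb{C}^n\times\mathbb{C}^{m\times N}$ with $\operatorname{diag}(\lambda)AX=Y$. Lebesgue measure on complex spaces is taken via the identification $\mathbb{C}\cong\mathbb{R}^2$. *)

(* Defs.v *)
From Stdlib Require Export Reals.
Open Scope R_scope.

Definition C : Type := (R * R)%type.
Definition C0 : C := (0, 0).
Definition Cmul (z w : C) : C :=
  (fst z * fst w - snd z * snd w, fst z * snd w + snd z * fst w).
Definition Cadd (z w : C) : C := (fst z + fst w, snd z + snd w).
Definition Cinv (z : C) : C :=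
  let d := fst z * fst z + snd z * snd z in (fst z / d, - snd z / d).

Fixpoint Csum (k : nat) (f : nat -> C) : C :=
  match k with
  | O => C0
  | S k' => Cadd (Csum k' f) (f k')
  end.

(* Vectors in C^n are functions nat -> C (only indices < n matter);
   matrices are functions nat -> nat -> C (only indices in range matter). *)

Definition diagAX (m : nat) (lam : nat -> C) (A X : nat -> nat -> C)
  (i k : nat) : C :=
  Cmul (lam i) (Csum m (fun j => Cmul (A i j) (X j k))).

Definition identifiable_up_to_scaling (n m N : nat)
  (lam0 : nat -> C) (X0 A : nat -> nat -> C) : Prop :=
  forall (lam : nat -> C) (X : nat -> nat -> C),
    (forall i k, (i < n)%nat -> (k < N)%nat ->
       diagAX m lam A X i k = diagAX m lam0 A X0 i k) ->
    exists sigma : C, sigma <> C0 /\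
      (forall i, (i < n)%nat -> lam i = Cmul sigma (lam0 i)) /\
      (forall j k, (j < m)%nat -> (k < N)%nat ->
         X j k = Cmul (Cinv sigma) (X0 j k)).

(* Lebesgue measure zero in R^d: points are p : nat -> R, coordinates j < d.
   Z is null iff for every eps > 0 it is covered by countably many closed
   boxes [a k, b k] whose total volume is < eps. *)
Fixpoint Rprod (d : nat) (f : nat -> R) : R :=
  match d with
  | O => 1
  | S d' => Rprod d' f * f d'
  end.

Definition lebesgue_null (d : nat) (Z : (nat -> R) -> Prop) : Prop :=
  forall eps : R, 0 < eps ->
    exists a b : nat -> nat -> R,
      (forall k j, (j < d)%nat -> a k j <= b k j) /\
      (forall p, Z p -> exists k, forall j, (j < d)%nat ->
                         a k j <= p j <= b k j) /\
      (forall K, sum_f_R0 (fun k => Rprod d (fun j => b k j - a k j)) K < eps).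

(* Coordinates of C^n x C^(m x N) x C^(n x m) as a point of R^(2(n+mN+nm)). *)
Definition param_dim (n m N : nat) : nat := (2 * (n + m * N + n * m))%nat.
Definition coordC (p : nat -> R) (o : nat) : C := (p (2 * o)%nat, p (2 * o + 1)%nat).
Definition dec_lam (p : nat -> R) : nat -> C := fun i => coordC p i.
Definition dec_X (n N : nat) (p : nat -> R) : nat -> nat -> C :=
  fun j k => coordC p (n + (j * N + k))%nat.
Definition dec_A (n m N : nat) (p : nat -> R) : nat -> nat -> C :=
  fun i j => coordC p (n + m * N + (i * m + j))%nat.

Definition almost_all_params (n m N : nat)
  (P : (nat -> C) -> (nat -> nat -> C) -> (nat -> nat -> C) -> Prop) : Prop :=
  exists Z : (nat -> R) -> Prop,
    lebesgue_null (param_dim n m N) Z /\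
    forall p, ~ Z p -> P (dec_lam p) (dec_X n N p) (dec_A n m N p).

(* Main.v *)
Require Import Defs.
From Stdlib Require Import Reals.
From mathcomp Require all_boot all_order all_algebra complex.
From mathcomp Require ring zify boolp Rstruct.
Open Scope R_scope.

(** Dividing by [lambda], identifiability says that [A W = diag(nu) A X0] with
    [nu_0 = 0] has only the solution [W = 0], [nu = 0], as soon as [lambda0] and
    the rows of [A X0] do not vanish.  If [B] is a left inverse of the matrix of
    this linear system at one fixed parameter, then at any parameter the system
    is injective where [det (M B)], a polynomial in the parameters, does not
    vanish; so it suffices to find one good parameter and to know that zero sets
    of nonzero polynomials are null.

    A good parameter: [A] is the identity on top of the 0/1 rows supported on
    windows of [N] consecutive indices, each window overlapping the previous one,
    and [X0 j k = 1] iff [j mod N = k].  Each window then forces the entries of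
    [nu] it meets to agree, and [n - 1 <= N (n - m)] says that [n - m] windows
    suffice to chain all [m] indices together.

    Zero sets: the number of points of the grid of mesh [1/K] in a cube at which
    a polynomial [f] is small is [o(K^d)], by induction on the degree.  Choose a
    coordinate direction in which all the differences of [f] are nonzero.  The
    translates of the set of small values by [i/k], [i < k], have small pairwise
    intersections, as there the difference of [f], of lower degree, is small;
    hence each of them occupies about [1/k] of the cube at most. *)

(* The module confines the MathComp notations, which would change the reading of
   the inequalities in the theorem. *)
Module Identifiability.
Import all_boot all_order all_algebra complex ring zify boolp Rstruct.
Set Implicit Arguments.
Unset Strict Implicit.
Unset Printing Implicit Defensive.
Import Order.TTheory GRing.Theory Num.Theory.
Local Open Scope ring_scope.

(** * Polynomial functions and their differences *)

Definition shift (F : nmodType) (I : Type) (v x : I -> F) : I -> F :=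
  fun i => x i + v i.

Definition along (F : nmodType) (I : eqType) (j : I) (t : F) : I -> F :=
  fun i => if i == j then t else 0.

Inductive polyfun (F : pzRingType) (I : Type) : nat -> ((I -> F) -> F) -> Prop :=
| PolyConst D c : polyfun D (fun=> c)
| PolyCoord D i : polyfun D.+1 (fun x => x i)
| PolyAdd D f g : polyfun D f -> polyfun D g -> polyfun D (fun x => f x + g x)
| PolyMul D E f g :
    polyfun D f -> polyfun E g -> polyfun (D + E) (fun x => f x * g x).

Lemma polyfun_ext (F : pzRingType) (I : Type) D (f g : (I -> F) -> F) :
  f =1 g -> polyfun D f -> polyfun D g.
Proof. by move=> /funext ->. Qed.

Lemma polyfunW (F : pzRingType) (I : Type) (D E : nat) (f : (I -> F) -> F) :
  (D <= E)%N -> polyfun D f -> polyfun E f.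
Proof.
move=> + Pf; elim: Pf E => {D f}.
- by move=> *; apply: PolyConst.
- by move=> D i [|E] // _; apply: PolyCoord.
- by move=> D f g _ IHf _ IHg E DE; apply: PolyAdd; [apply: IHf|apply: IHg].
move=> D D' f g _ IHf _ IHg E DE.
have -> : (E = D + (E - D))%N by lia.
by apply: PolyMul; [apply: IHf|apply: IHg; lia].
Qed.

Lemma polyfun_shift (F : pzRingType) (I : Type) D (f : (I -> F) -> F) v :
  polyfun D f -> polyfun D (fun x => f (shift v x)).
Proof.
elim=> {D f} [D c|D i|D f g _ IHf _ IHg|D E f g _ IHf _ IHg].
- exact: PolyConst.
- apply: PolyAdd; [exact: PolyCoord|exact: PolyConst].
- exact: PolyAdd.
- exact: PolyMul.
Qed.

(** Product rule: [d(fg) = df * g(. + v) + f * dg]. The first conjunct serves a factor of degree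
    bound 0: there the truncated predecessor does not decrease, and the term with its difference
    must be seen to vanish. *)
Lemma polyfun_diff (F : pzRingType) (I : Type) D (f : (I -> F) -> F) :
  polyfun D f ->
  (D = 0%N -> forall v x, f (shift v x) = f x) /\
  (forall v, polyfun D.-1 (fun x => f (shift v x) - f x)).
Proof.
elim=> {D f} [D c|D i|D f g _ [f0 df] _ [g0 dg]|D E f g Pf [f0 df] Pg [g0 dg]].
- by split=> // v; apply: polyfun_ext (PolyConst _ _ 0) => x; rewrite subrr.
- by split=> // v; apply: polyfun_ext (PolyConst _ _ (v i)) => x;
    rewrite /shift addrAC subrr add0r.
- split=> [D0 v x|v]; first by rewrite f0 // g0.
  by apply: polyfun_ext (PolyAdd (df v) (dg v)) => x; rewrite addrACA opprD.
split=> [DE v x|v]; first by rewrite f0 ?g0 //; lia.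
have [D0|D0] := eqVneq D 0%N.
  apply: polyfun_ext (polyfunW _ (PolyMul Pf (dg v))); last by lia.
  by move=> x; rewrite f0 // mulrBr.
have [E0|E0] := eqVneq E 0%N.
  apply: polyfun_ext (polyfunW _ (PolyMul (df v) Pg)); last by lia.
  by move=> x; rewrite g0 // mulrBl.
apply: polyfun_ext
  (PolyAdd (polyfunW _ (PolyMul (df v) (polyfun_shift v Pg)))
           (polyfunW _ (PolyMul Pf (dg v)))); try by lia.
by move=> x; rewrite mulrBl mulrBr addrA subrK.
Qed.

Lemma polyfun_line (F : comNzRingType) (I : Type) D (f : (I -> F) -> F) :
  polyfun D f ->
  forall x v, exists p : {poly F}, forall u, f (fun i => x i + u * v i) = p.[u].
Proof.
elim=> {D f} [D c|D i|D f g _ IHf _ IHg|D E f g _ IHf _ IHg] x v.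
- by exists c%:P => u; rewrite hornerC.
- by exists ((x i)%:P + 'X * (v i)%:P) => u; rewrite !hornerE.
- by have [[p pE] [q qE]] := (IHf x v, IHg x v); exists (p + q) => u;
    rewrite hornerD pE qE.
- by have [[p pE] [q qE]] := (IHf x v, IHg x v); exists (p * q) => u;
    rewrite hornerM pE qE.
Qed.

(** [p - p(0)] vanishes at all multiples [k t], which are distinct in characteristic 0. *)
Lemma periodic_poly (F : numFieldType) (p : {poly F}) (t : F) :
  t != 0 -> (forall u, p.[u + t] = p.[u]) -> forall u, p.[u] = p.[0].
Proof.
move=> t0 per.
have pk k : p.[k%:R * t] = p.[0].
  elim: k => [|k IHk]; first by rewrite mul0r.
  by rewrite -addn1 natrD mulrDl mul1r per.
pose q := p - (p.[0])%:P.
have q0 : q = 0.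
  apply: (@roots_geq_poly_eq0 _ _ [seq k%:R * t | k <- iota 0 (size q)]).
  - by apply/allP => _ /mapP[k _ ->]; rewrite rootE !hornerE pk subrr.
  - rewrite map_inj_uniq ?iota_uniq // => k l /(mulIf t0) /eqP.
    by rewrite eqr_nat => /eqP.
  - by rewrite size_map size_iota.
move=> u; have : q.[u] = 0 by rewrite q0 horner0.
by rewrite !hornerE => /eqP; rewrite subr_eq0 => /eqP.
Qed.

Lemma const_along (F : zmodType) (I : finType) (f : (I -> F) -> F) :
  (forall j t x, f (shift (along j t) x) = f x) -> forall x y, f x = f y.
Proof.
(* Pass from [x] to [y] one coordinate at a time; [z s] has already changed those in [s]. *)
move=> fc x y; pose z (s : seq I) i := if i \in s then y i else x i.
have fz s : f (z s) = f x.
  elim: s => [|j s IHs]; first by congr f; apply/funext => i; rewrite /z in_nil.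
  rewrite -IHs -(fc j (z (j :: s) j - z s j) (z s)); congr f; apply/funext => i.
  rewrite /shift /along; case: eqP => [->|/eqP ij]; first by rewrite addrC subrK.
  by rewrite addr0 /z in_cons (negPf ij).
rewrite -(fz (enum I)); congr f; apply/funext => i.
by rewrite /z mem_enum.
Qed.

(** A nonconstant [f] varies along some line parallel to an axis. If its difference by one [t != 0]
    vanished everywhere, its restriction to that line would be a periodic polynomial, hence
    constant. The direction [j] is independent of [t], so it serves all translates at once. *)
Lemma polyfun_const_or_diff (F : numFieldType) (I : finType) D
    (f : (I -> F) -> F) :
  polyfun D f ->
  (forall x y, f x = f y) \/
  exists j, forall t, t != 0 -> exists x, f (shift (along j t) x) - f x != 0.
Proof.
move=> Pf; have [|/existsNP[j /existsNP[s /existsNP[x /eqP fx]]]] :=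
  pselect (forall j t x, f (shift (along j t) x) = f x).
  by move/const_along; left.
right; exists j => t t0; apply/not_existsP => all0.
have [p pE] := polyfun_line Pf x (along j 1).
have lineE u : f (shift (along j u) x) = p.[u].
  rewrite -pE; congr f; apply/funext => i; rewrite /shift /along.
  by case: eqP; rewrite ?mulr1 ?mulr0.
have per u : p.[u + t] = p.[u].
  apply/eqP; rewrite -subr_eq0; apply/negPn/negP => /= neq.
  apply: (all0 (shift (along j u) x)).
  suff -> : shift (along j t) (shift (along j u) x) = shift (along j (u + t)) x.
    by rewrite !lineE.
  apply/funext => i; rewrite /shift /along -addrA.
  by case: eqP => //; rewrite addr0.
case/negP: fx; apply/eqP; rewrite lineE (periodic_poly t0 per).
rewrite -lineE; congr f; apply/funext => i; rewrite /shift /along.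
by case: eqP; rewrite addr0.
Qed.

(** * Small values on a grid *)

(** Bonferroni's inequality for the union of the [E i], itself of size at most [#|T|]. *)
Lemma sum_card_le_pairwise (T : finType) (E : nat -> {set T}) (k : nat) :
  (\sum_(i < k) #|E i| <= #|T| + \sum_(l < k) \sum_(i < l) #|E i :&: E l|)%N.
Proof.
apply: (@leq_trans (#|\bigcup_(i < k) E i| +
    \sum_(l < k) \sum_(i < l) #|E i :&: E l|)); last by rewrite leq_add2r max_card.
elim: k => [|k IHk]; first by rewrite !big_ord0.
have arith (a b c d e g : nat) : (a <= b + c -> d <= b -> d <= g ->
  a + e <= b + e - d + (c + g))%N by lia.
rewrite !big_ord_recr /= cardsU; apply: arith IHk _ _.
  exact/subset_leq_card/subsetIl.
rewrite big_distrl /=.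
elim/big_ind2: _ => [|A a B b Aa Bb|//]; first by rewrite cards0.
  by apply: leq_trans (leq_add Aa Bb); rewrite cardsU leq_subr.
Qed.

Definition grid_point (F : fieldType) (I : finType) (K n : nat)
    (z : {ffun I -> 'I_n.+1}) : I -> F :=
  fun i => (z i)%:R / K%:R.

Definition small_values (F : realFieldType) (I : finType) (f : (I -> F) -> F)
    (M K : nat) (eta : F) : {set {ffun I -> 'I_(M * K).+1}} :=
  [set z | `|f (grid_point F K z)| <= eta].

(** Restricting [K] to multiples of [K0] lets translations by [i/k] preserve the grid, and lets
    finitely many conditions be combined by multiplying their [K0]. *)
Definition few_small_values (F : realFieldType) (I : finType)
    (f : (I -> F) -> F) (M : nat) (eps eta : F) (K0 : nat) :=
  forall K, (K0 %| K)%N -> (0 < K)%N ->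
    #|small_values f M K eta|%:R <= eps * K%:R ^+ #|I|.

Lemma few_small_valuesW (F : realFieldType) (I : finType) (f : (I -> F) -> F)
    M (eps eta eta' : F) K0 K0' :
  eta' <= eta -> (K0 %| K0')%N ->
  few_small_values f M eps eta K0 -> few_small_values f M eps eta' K0'.
Proof.
move=> le_eta dvdK few K K0'K Kgt0.
apply: le_trans (few K (dvdn_trans dvdK K0'K) Kgt0).
rewrite ler_nat subset_leq_card //; apply/subsetP => z; rewrite !inE => /le_trans.
exact.
Qed.

(** With [d = #|I|], the [k] translates have equal size and lie in the grid of [[0, M+1]^d], of at
    most [(M+2)^d K^d] points because [(M+1)K + 1 <= (M+2)K]. Bonferroni bounds [k] times their size
    by [(M+2)^d K^d + k^2 eps K^d]. The threshold is halved for the triangle inequality. *)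
Lemma few_small_values_translate (F : realFieldType) (I : finType)
    (f : (I -> F) -> F) (j : I) (M k : nat) (eps eta : F) (K0 : nat) :
  (0 < k)%N -> 0 <= eps ->
  (forall t, (0 < t < k)%N ->
     few_small_values (fun x => f (shift (along j (t%:R / k%:R)) x) - f x)
       M eps eta K0) ->
  few_small_values f M (M.+2%:R ^+ #|I| / k%:R + k%:R * eps) (eta / 2) (K0 * k).
Proof.
move=> k0 eps0 fewD K K0K Kgt0.
have [K0dvd kdvd] : (K0 %| K)%N /\ (k %| K)%N.
  by split; apply: dvdn_trans K0K; [exact: dvdn_mulr|exact: dvdn_mull].
pose s := (K %/ k)%N; have KE : (K = s * k)%N by rewrite divnK.
have [kF0 KF0] : k%:R != 0 :> F /\ K%:R != 0 :> F by rewrite !pnatr_eq0; lia.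
have KFE : K%:R = s%:R * k%:R :> F by rewrite -natrM -KE.
have sF0 : s%:R != 0 :> F by move: KF0; rewrite KFE mulf_eq0 => /norP[].
pose E0 := small_values f M K (eta / 2).
(* Moving by [i * s] grid steps is translating by [i/k]; the enlarged range keeps [inord] from its
   default value when [i <= k]. *)
pose tr i (z : {ffun I -> 'I_(M * K).+1}) : {ffun I -> 'I_(M.+1 * K).+1} :=
  [ffun l => inord (z l + (l == j) * (i * s))].
have trE i z l : (i <= k)%N -> tr i z l = (z l + (l == j) * (i * s))%N :> nat.
  move=> ik; rewrite ffunE inordK // ltnS mulSn addnC leq_add //.
    by case: eqP; rewrite ?mul0n // mul1n KE mulnC leq_mul.
  by rewrite -ltnS ltn_ord.
have tr_inj i : (i <= k)%N -> injective (tr i).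
  move=> ik z z' /ffunP zz'; apply/ffunP => l; apply/val_inj => /=.
  by have /(congr1 val) /= := zz' l; rewrite !trE // => /addIn.
pose E i := tr i @: E0.
have cardE (i : 'I_k) : #|E i| = #|E0| by rewrite card_imset //; apply/tr_inj/ltnW.
(* A common point of two translates comes from two small values of [f] that
   differ by a translation, hence from a small value of a difference of [f]. *)
have cardI (l : 'I_k) (i : 'I_l) :
    #|E i :&: E l|%:R <= eps * K%:R ^+ #|I|.
  have [il lk] := (ltn_ord i, ltn_ord l).
  have t_k : (0 < l - i < k)%N by lia.
  apply: le_trans (fewD _ t_k K K0dvd Kgt0).
  rewrite ler_nat; apply: leq_trans (leq_imset_card (tr l) _).
  apply/subset_leq_card/subsetP => _ /setIP[/imsetP[z zE ->] /imsetP[z' z'E zz']].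
  rewrite zz'; apply: imset_f; rewrite inE.
  have -> : shift (along j ((l - i)%:R / k%:R)) (grid_point F K z') = grid_point F K z.
    apply/funext => n; rewrite /shift /along /grid_point.
    have /ffunP/(_ n)/(congr1 val) /= := zz'; rewrite !trE; try lia.
    case: eqP => _; rewrite ?mul0n ?mul1n ?addn0; last by move=> ->; rewrite addr0.
    move=> e; have -> : (z n = z' n + (l - i) * s :> nat)%N.
      apply/eqP; rewrite -(eqn_add2r (i * s)) e -addnA -mulnDl subnK //.
      exact: ltnW.
    by rewrite natrD natrM KFE; field; rewrite sF0 kF0.
  move: zE z'E; rewrite !inE => zE z'E.
  by rewrite [leRHS](splitr eta) (le_trans (ler_normB _ _)) // lerD.
have := sum_card_le_pairwise E k.
under eq_bigr do rewrite cardE.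
rewrite sum_nat_const card_ord card_ffun card_ord -(ler_nat F) natrD natrM natr_sum.
set S := \sum_(l < k) _.
have S_le : S <= k%:R * (k%:R * eps * K%:R ^+ #|I|).
  have -> : k%:R * (k%:R * eps * K%:R ^+ #|I|) =
     \sum_(l < k) (k%:R * eps * K%:R ^+ #|I|).
    by rewrite sumr_const card_ord [LHS]mulr_natl.
  apply: ler_sum => l _; rewrite natr_sum.
  apply: (@le_trans _ _ (\sum_(i < l) (eps * K%:R ^+ #|I|))).
    by apply: ler_sum => i _.
  rewrite sumr_const card_ord -[leLHS]mulr_natl -mulrA.
  by rewrite ler_wpM2r ?mulr_ge0 ?exprn_ge0 // ler_nat ltnW.
have T_le : ((M.+1 * K).+1 ^ #|I|)%:R <= M.+2%:R ^+ #|I| * K%:R ^+ #|I| :> F.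
  rewrite natrX -exprMn -natrM; apply: lerXn2r; rewrite ?nnegrE ?ler0n // ler_nat.
  nia.
move=> /le_trans /(_ (lerD T_le S_le)) le_k.
rewrite -(ler_pM2l (_ : 0 < k%:R)) ?ltr0n // (le_trans le_k) //.
rewrite le_eqVlt; apply/orP; left; apply/eqP.
by set X := K%:R ^+ _; set C := M.+2%:R ^+ _; field.
Qed.

Lemma const_few_small_values (F : archiRealFieldType) (I : finType)
    (f : (I -> F) -> F) (M : nat) (eps : F) :
  (forall x y, f x = f y) -> (exists x, f x != 0) -> 0 < eps ->
  exists eta K0, [/\ 0 < eta, (0 < K0)%N & few_small_values f M eps eta K0].
Proof.
move=> f_const [x0 fx0] eps0; have f0 : 0 < `|f x0| by rewrite normr_gt0.
exists (`|f x0| / 2), 1%N; split=> //; first by rewrite divr_gt0.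
move=> K _ _; rewrite (_ : small_values _ _ _ _ = finset.set0) ?cards0.
  exact: mulr_ge0 (ltW eps0) (exprn_ge0 _ (ler0n _ _)).
apply/setP => z; rewrite !inE; apply/negbTE; rewrite -ltNge (f_const _ x0).
by rewrite ltr_pdivrMr // ltr_pMr // ltr1n.
Qed.

Lemma polyfun_few_small_values (F : archiRealFieldType) (I : finType) D
    (f : (I -> F) -> F) (M : nat) (eps : F) :
  polyfun D f -> (exists x, f x != 0) -> 0 < eps ->
  exists eta K0, [/\ 0 < eta, (0 < K0)%N & few_small_values f M eps eta K0].
Proof.
elim: D f M eps => [|D IHD] f M eps Pf f0 eps0;
    have [f_const|[j fj]] := polyfun_const_or_diff Pf;
    try exact: const_few_small_values.
  (* Under the bound 0 all differences vanish. *)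
  have [x] := fj 1 (oner_neq0 _); have [-> //] := polyfun_diff Pf.
  by rewrite subrr eqxx.
have [_ /(_ (along j _)) Pdf] := polyfun_diff Pf.
pose C : F := M.+2%:R ^+ #|I|.
have C0 : 0 < C by rewrite exprn_gt0.
(* This [k] makes the main term [C / k] at most [eps / 2]; [delta] is chosen so that the overlaps
   contribute [k * delta = eps / 2]. *)
pose k := (Num.truncn (2 * C / eps)).+1.
have k0 : 0 < k%:R :> F by rewrite ltr0n.
have Ck : C / k%:R <= eps / 2.
  have : 2 * C / eps < k%:R := truncnS_gt _.
  rewrite ltr_pdivrMr // => H; rewrite ler_pdivrMr // mulrAC ler_pdivlMr //.
  by rewrite mulrC [eps * _]mulrC ltW.
pose delta := eps / 2 / k%:R.
have delta0 : 0 < delta by rewrite !divr_gt0.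
(* One [eta] and one [K0] for the finitely many differences: a minimum and a product. *)
have [eta [K0 [eta0 K00 few]]] : exists eta K0, [/\ 0 < eta, (0 < K0)%N &
    forall t, (0 < t < k)%N -> few_small_values
      (fun x => f (shift (along j (t%:R / k%:R)) x) - f x) M delta eta K0].
  elim: {1}k => [|n [eta [K0 [eta0 K00 IHn]]]].
    by exists 1, 1%N; split=> // t; rewrite ltn0 andbF.
  have [n0|n0] := posnP n.
    by exists 1, 1%N; split=> // t; rewrite n0; lia.
  have [|eta' [K0' [eta0' K00' fewn]]] := IHD _ M delta (Pdf (n%:R / k%:R)) _ delta0.
    by apply: fj; rewrite mulf_neq0 ?invr_eq0 ?pnatr_eq0 //; lia.
  exists (Num.min eta eta'), (K0 * K0')%N; split; rewrite ?lt_min ?eta0 ?muln_gt0 ?K00 //.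
  move=> t /andP[t0]; rewrite ltnS leq_eqVlt => /predU1P[->|tn].
    by apply: few_small_valuesW fewn; rewrite ?ge_min ?lexx ?orbT // dvdn_mull.
  apply: few_small_valuesW (IHn t _); rewrite ?ge_min ?lexx // ?t0 //.
  exact: dvdn_mulr.
exists (eta / 2), (K0 * k)%N; split; rewrite ?divr_gt0 ?muln_gt0 ?K00 //.
move=> K dvdK Kgt0.
have := few_small_values_translate (isT : 0 < k)%N (ltW delta0) few dvdK Kgt0.
move/le_trans; apply; rewrite ler_wpM2r ?exprn_ge0 //.
rewrite [leRHS](splitr eps) lerD // /delta mulrC divfK //.
by rewrite gt_eqF.
Qed.

(** * Covering zero sets by cubes *)

(** Boundedness is proved along with the Lipschitz bound because the increment of a product involves
    the sizes of its factors. *)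
Lemma polyfun_lipschitz (F : realFieldType) (I : Type) D (f : (I -> F) -> F)
    (M : F) :
  polyfun D f -> 0 <= M ->
  exists2 C, 0 <= C & forall x y h, 0 <= h ->
    (forall i, `|x i| <= M) -> (forall i, `|y i| <= M) ->
    (forall i, `|x i - y i| <= h) -> `|f x| <= C /\ `|f x - f y| <= C * h.
Proof.
move=> Pf M0; elim: Pf => {D f}
  [D c|D i|D f g _ [C C0 HC] _ [E E0 HE]|D D' f g _ [C C0 HC] _ [E E0 HE]].
- by exists `|c| => // x y h h0 _ _ _; rewrite subrr normr0 mulr_ge0.
- exists (M + 1) => [|x y h h0 xM _ xy]; first by rewrite addr_ge0.
  rewrite (le_trans (xM i)) ?lerDl // (le_trans (xy i)) //.
  by rewrite mulrDl mul1r lerDr mulr_ge0.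
- exists (C + E) => [|x y h h0 xM yM xy]; first by rewrite addr_ge0.
  have [[fx fxy] [gx gxy]] := (HC _ _ _ h0 xM yM xy, HE _ _ _ h0 xM yM xy).
  rewrite (le_trans (ler_normD _ _)) ?lerD //; split=> //.
  by rewrite opprD addrACA mulrDl (le_trans (ler_normD _ _)) ?lerD.
exists (2 * (C * E)) => [|x y h h0 xM yM xy]; first by rewrite !mulr_ge0.
have [[fx fxy] [gx gxy]] := (HC _ _ _ h0 xM yM xy, HE _ _ _ h0 xM yM xy).
have yy i : `|y i - y i| <= h by rewrite subrr normr0.
have [gy _] := HE _ _ _ h0 yM yM yy.
split.
  rewrite normrM (le_trans (ler_pM _ _ fx gx)) //.
  by rewrite mulr2n mulrDl mul1r lerDl mulr_ge0.
have -> : f x * g x - f y * g y = f x * (g x - g y) + (f x - f y) * g y by ring.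
rewrite (le_trans (ler_normD _ _)) // !normrM.
have -> : 2 * (C * E) * h = C * (E * h) + C * h * E by ring.
by rewrite lerD ?ler_pM.
Qed.

Definition in_cube (F : numDomainType) (I : finType) (x : I -> F)
    (q : {ffun I -> F} * F) : Prop :=
  forall i, q.1 i <= x i <= q.1 i + q.2.

Definition covered (F : realFieldType) (I : finType) (P : (I -> F) -> Prop)
    (eps : F) : Prop :=
  exists s : seq ({ffun I -> F} * F),
    [/\ forall q, q \in s -> 0 <= q.2,
        forall x, P x -> exists2 q, q \in s & in_cube x q &
        \sum_(q <- s) q.2 ^+ #|I| <= eps].

(** The lower corner of the grid cell of a zero is a point of small value, by the Lipschitz bound;
    there are few such corners, and each cell has volume [K^-d]. *)
Lemma zeros_covered_orthant (F : archiRealFieldType) (I : finType) D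
    (f : (I -> F) -> F) (M : nat) (eps : F) :
  polyfun D f -> (exists x, f x != 0) -> 0 < eps ->
  covered (fun x => f x = 0 /\ forall i, 0 <= x i <= M%:R) eps.
Proof.
move=> Pf f0 eps0.
have [eta [K0 [eta0 K00 few]]] := polyfun_few_small_values M Pf f0 eps0.
have [C C0 lip] := polyfun_lipschitz Pf (ler0n _ M).
(* A multiple of [K0] exceeding [C / eta], so that one mesh changes [f] by at most
   [C / K <= eta]. *)
pose K := (K0 * (Num.truncn (C / eta)).+1)%N.
have K_gt0 : (0 < K)%N by rewrite muln_gt0 K00.
have K0F : 0 < K%:R :> F by rewrite ltr0n.
have CK : C * K%:R^-1 <= eta.
  rewrite ler_pdivrMr // mulrC -ler_pdivrMr // (le_trans (ltW (truncnS_gt _))) //.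
  by rewrite ler_nat leq_pmull.
pose cube (z : {ffun I -> 'I_(M * K).+1}) : {ffun I -> F} * F :=
  ([ffun i => grid_point F K z i], K%:R^-1).
exists [seq cube z | z <- enum (small_values f M K eta)]; split.
- by move=> _ /mapP[z _ ->] /=; rewrite invr_ge0 ltW.
- move=> x [fx0 xM].
  pose z : {ffun I -> 'I_(M * K).+1} := [ffun i => inord (Num.truncn (x i * K%:R))].
  have zx i : grid_point F K z i <= x i <= grid_point F K z i + K%:R^-1.
    have [x0 xM'] := andP (xM i).
    have xK0 : 0 <= x i * K%:R by rewrite mulr_ge0 // ltW.
    rewrite /grid_point ffunE inordK.
      have /andP[t1 t2] := truncn_itv xK0.
      rewrite ler_pdivrMr // t1 /= -[X in _ <= _ + X]mul1r -mulrDl.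
      by rewrite ler_pdivlMr // natr1 ltW.
    rewrite ltnS -(ler_nat F) (le_trans (_ : _ <= x i * K%:R)) ?truncn_le //.
    by rewrite natrM ler_wpM2r // ltW.
  exists (cube z); last by move=> i; rewrite /= ffunE.
  apply: map_f; rewrite mem_enum inE.
  have -> : f (grid_point F K z) = f (grid_point F K z) - f x by rewrite fx0 subr0.
  apply: le_trans CK; apply: (lip _ _ _ _ _ _ _).2.
  + by rewrite invr_ge0 ltW.
  + move=> i; have /andP[zx1 _] := zx i; have /andP[_ xM1] := xM i.
    rewrite ger0_norm ?(le_trans zx1) //.
    by rewrite /grid_point divr_ge0 // ltW.
  + by move=> i; have /andP[x0 xM1] := xM i; rewrite ger0_norm.
  + move=> i; have /andP[zx1 zx2] := zx i.
    by rewrite distrC ger0_norm ?subr_ge0 // lerBlDl.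
rewrite big_map /= big_const_seq count_predT -cardE iter_addr_0 exprVn.
rewrite -[leLHS]mulr_natl ler_pdivrMr ?exprn_gt0 //.
by apply: few => //; apply: dvdn_mulr.
Qed.

Lemma zeros_covered (F : archiRealFieldType) (I : finType) D
    (f : (I -> F) -> F) (M : nat) (eps : F) :
  polyfun D f -> (exists x, f x != 0) -> 0 < eps ->
  covered (fun x => f x = 0 /\ forall i, `|x i| <= M%:R) eps.
Proof.
(* The cube [[-M, M]^d] is [[0, 2M]^d] translated by [-M]. *)
move=> Pf [x0 fx0] eps0; pose v (i : I) : F := - M%:R.
have [|s [s0 cov vol]] :=
    zeros_covered_orthant (M + M) (polyfun_shift v Pf) _ eps0.
  exists (shift (fun=> M%:R) x0); suff -> : shift v (shift (fun=> M%:R) x0) = x0 by [].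
  by apply/funext => i; rewrite /shift /v addrK.
pose move_cube (q : {ffun I -> F} * F) : {ffun I -> F} * F :=
  ([ffun i => q.1 i - M%:R], q.2).
exists [seq move_cube q | q <- s]; split.
- by move=> _ /mapP[q qs ->]; exact: s0 q qs.
- move=> x [fx xM]; have [|q qs xq] := cov (shift (fun=> M%:R) x).
    split=> [|i]; last first.
      by have := xM i; rewrite ler_norml natrD /shift -lerBlDr sub0r lerD2r.
    by rewrite -[RHS]fx; congr f; apply/funext => i; rewrite /shift /v addrK.
  exists (move_cube q); first exact: map_f.
  move=> i; rewrite /= ffunE; have := xq i; rewrite /shift.
  by rewrite lerBlDr addrAC lerBrDr.
by rewrite big_map.
Qed.

(* Nonemptiness makes the k-th entry available after k lists, so that initial
   segments of [q] stay within initial segments of the family. *)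
Lemma enumerate_flatten (T : eqType) (L : nat -> seq T) :
  (forall n, (0 < size (L n))%N) ->
  exists q : nat -> T, (forall n t, t \in L n -> exists k, q k = t) /\
    (forall K, exists r, flatten (mkseq L K) = mkseq q K ++ r).
Proof.
move=> L0; have [t0 _] : exists t0 : T, True.
  by case: (L 0) (L0 0) => // t0; exists t0.
pose flat n := flatten (mkseq L n).
have flatS n : flat n.+1 = flat n ++ L n.
  by rewrite /flat /mkseq -addn1 iotaD map_cat flatten_cat /= cats0.
have size_flat n : (n <= size (flat n))%N.
  elim: n => // n IHn; rewrite flatS size_cat -addn1 leq_add //.
have nth_flat k m n : (m <= n)%N -> (k < size (flat m))%N ->
    nth t0 (flat n) k = nth t0 (flat m) k.
  move=> /subnKC <-; elim: (n - m)%N => [|e IHe] km; first by rewrite addn0.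
  rewrite addnS flatS nth_cat -IHe // ifT //.
  apply: leq_trans km _; elim: e {IHe} => [|e IHe]; first by rewrite addn0.
  by rewrite addnS flatS size_cat (leq_trans IHe) ?leq_addr.
have nth_flat2 k m n : (k < size (flat n))%N -> (k < size (flat m))%N ->
    nth t0 (flat n) k = nth t0 (flat m) k.
  by case: (leqP m n) => [/nth_flat|/ltnW /nth_flat] H kn km; rewrite H.
pose q k := nth t0 (flat k.+1) k.
exists q; split=> [n t tL|K].
  have tf : t \in flat n.+1 by rewrite flatS mem_cat tL orbT.
  exists (index t (flat n.+1)).
  by rewrite /q (nth_flat2 _ n.+1) ?nth_index ?index_mem.
exists (drop K (flat K)); rewrite -[LHS](cat_take_drop K); congr (_ ++ _).
apply: (@eq_from_nth _ t0) => [|k]; first by rewrite size_mkseq size_takel.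
rewrite size_takel // => kK; rewrite nth_take // nth_mkseq //.
by apply: nth_flat2; rewrite ?size_flat // (leq_trans kK).
Qed.

(** Exhaust the space by the cubes [|x i| <= M], spending [eps / 2^(M+1)] on the [M]-th. *)
Lemma zeros_null (F : archiRealFieldType) (I : finType) D
    (f : (I -> F) -> F) (eps : F) :
  (0 < #|I|)%N -> polyfun D f -> (exists x, f x != 0) -> 0 < eps ->
  exists q : nat -> {ffun I -> F} * F,
    [/\ forall k, 0 <= (q k).2,
        forall x, f x = 0 -> exists k, in_cube x (q k) &
        forall K, \sum_(k < K) (q k).2 ^+ #|I| < eps].
Proof.
move=> I0 Pf f0 eps0.
have epsM M : 0 < eps / 2 ^+ M.+1 by rewrite divr_gt0 ?exprn_gt0.
have /choice[s sP] M := zeros_covered M Pf f0 (epsM M).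
(* A degenerate cube, of volume 0 because [I] is nonempty, pads each cover. *)
pose c0 : {ffun I -> F} * F := ([ffun=> 0], 0).
have [//|q [q_onto q_flat]] := @enumerate_flatten _ (fun M => c0 :: s M).
have L0 M p : p \in c0 :: s M -> 0 <= p.2.
  by rewrite inE => /predU1P[->//|]; have [+ _ _] := sP M; apply.
exists q; split=> [k|x fx|K].
- have [r qr] := q_flat k.+1.
  have : q k \in flatten (mkseq (fun M => c0 :: s M) k.+1).
    by rewrite qr mem_cat map_f // mem_iota leq0n ltnSn.
  by case/flattenP => _ /mapP[M _ ->]; apply: L0.
- pose M := \max_i (Num.truncn `|x i|).+1.
  have xM i : `|x i| <= M%:R.
    apply: le_trans (ltW (truncnS_gt _)) _; rewrite ler_nat.
    exact: (@leq_bigmax I (fun i => (Num.truncn `|x i|).+1) i).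
  have [_ /(_ x (conj fx xM)) [p ps xp] _] := sP M.
  have [|k kE] := q_onto M p; first by rewrite inE ps orbT.
  by exists k; rewrite kE.
have [r qr] := q_flat K.
(* The remainder [eps / 2^K] makes the final inequality strict. *)
have geom : \sum_(M < K) eps / 2 ^+ M.+1 = eps - eps / 2 ^+ K.
  elim: K {r qr} => [|K IHK]; first by rewrite big_ord0 expr0 divr1 subrr.
  rewrite big_ord_recr /= IHK exprS; field.
  by rewrite expf_neq0 ?pnatr_eq0.
apply: (@le_lt_trans _ _ (eps - eps / 2 ^+ K)); last first.
  by rewrite ltrBlDr ltrDl divr_gt0 ?exprn_gt0.
rewrite -geom; apply: (@le_trans _ _
  (\sum_(p <- flatten (mkseq (fun M => c0 :: s M) K)) p.2 ^+ #|I|)).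
  rewrite qr big_cat /= big_map -(big_mkord xpredT (fun k => (q k).2 ^+ #|I|)).
  rewrite /index_iota subn0 lerDl.
  rewrite big_seq sumr_ge0 // => p pr; rewrite exprn_ge0 //.
  have : p \in flatten (mkseq (fun M => c0 :: s M) K) by rewrite qr mem_cat pr orbT.
  by case/flattenP => _ /mapP[M _ ->]; apply: L0.
rewrite big_flatten big_map -(big_mkord xpredT (fun M => eps / 2 ^+ M.+1)).
rewrite /index_iota subn0; apply: ler_sum => M _.
rewrite big_cons expr0n eqn0Ngt I0 /= add0r.
by have [_ _] := sP M.
Qed.

(** * Transfer to [lebesgue_null] *)

Definition extend (d : nat) (x : 'I_d -> R) (j : nat) : R :=
  if insub j is Some i then x i else 0.

Lemma extendE d (x : 'I_d -> R) (i : 'I_d) : extend x i = x i.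
Proof. by rewrite /extend valK. Qed.

Lemma Rprod_const d (f : nat -> R) (c : R) :
  (forall j, (j < d)%N -> f j = c) -> Rprod d f = c ^+ d.
Proof.
elim: d => [|d IHd] fc //=.
by rewrite fc // IHd ?exprSr // => j jd; rewrite fc // ltnW.
Qed.

Lemma sum_f_R0E (f : nat -> R) K : sum_f_R0 f K = \sum_(k < K.+1) f k.
Proof.
elim: K => [|K IHK]; first by rewrite big_ord_recr big_ord0 /= add0r.
by rewrite big_ord_recr /= -IHK.
Qed.

Lemma polyfun_zeros_null d D (f : ('I_d -> R) -> R) :
  (0 < d)%N -> polyfun D f -> (exists x, f x != 0) ->
  lebesgue_null d (fun p => f (fun i => p i) = 0).
Proof.
move=> d0 Pf f0 eps /RltP eps0.
have [|q [q0 cov vol]] := zeros_null _ Pf f0 eps0; first by rewrite card_ord.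
exists (fun k => extend (q k).1), (fun k j => extend (q k).1 j + (q k).2).
split; [|split].
- by move=> k j _; apply/RleP; rewrite lerDl.
- move=> p /cov[k xq]; exists k => j /ssrnat.ltP jd.
  have /andP[] := xq (Ordinal jd).
  by rewrite -!(extendE (q k).1) => /RleP ? /RleP ?.
move=> K; rewrite sum_f_R0E; apply/RltP; apply: le_lt_trans (vol K.+1).
rewrite le_eqVlt; apply/orP; left; apply/eqP; apply: eq_bigr => k _.
rewrite card_ord; apply: Rprod_const => j _.
by rewrite RminusE addrC addKr.
Qed.

(** * The linear system *)

(** When [Y = A X0], the pair [nu = 1], [W = X0] always solves the equations, reflecting the scaling
    ambiguity; the condition at index 0 is there to exclude it. *)
Definition trivial_kernel (K : pzRingType) (n m N : nat)
    (A : 'I_n -> 'I_m -> K) (Y : 'I_n -> 'I_N -> K) : Prop :=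
  forall (nu : 'I_n -> K) (W : 'I_m -> 'I_N -> K),
    (forall i k, \sum_j A i j * W j k = nu i * Y i k) ->
    (forall i : 'I_n, i = 0%N :> nat -> nu i = 0) ->
    (forall i, nu i = 0) /\ (forall j k, W j k = 0).

(* Unknowns are [inl i] for [nu i] and [inr (j, k)] for [W j k]; equations are
   [Some (i, k)] for the entries of [A W - diag(nu) Y] and [None] for [nu_0 = 0]. *)
Definition system_coef (K : pzRingType) (n m N : nat)
    (A : 'I_n -> 'I_m -> K) (Y : 'I_n -> 'I_N -> K)
    (c : 'I_n + 'I_m * 'I_N) (e : option ('I_n * 'I_N)) : K :=
  match c, e with
  | inl i', Some (i, k) => - (Y i k *+ (i' == i))
  | inr (j, k'), Some (i, k) => A i j *+ (k' == k)
  | inl i', None => (i' == 0%N :> nat)%:R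
  | inr _, None => 0
  end.

Definition system_mx (K : pzRingType) (n m N : nat)
    (A : 'I_n -> 'I_m -> K) (Y : 'I_n -> 'I_N -> K) :
    'M[K]_(#|{: 'I_n + 'I_m * 'I_N}|, #|{: option ('I_n * 'I_N)}|) :=
  \matrix_(a, b) system_coef A Y (enum_val a) (enum_val b).

Definition system_row (K : Type) (n m N : nat)
    (u : 'I_n + 'I_m * 'I_N -> K) : 'rV[K]_(#|{: 'I_n + 'I_m * 'I_N}|) :=
  \row_a u (enum_val a).

Lemma mul_system_mx (K : fieldType) (n m N : nat)
    (A : 'I_n -> 'I_m -> K) (Y : 'I_n -> 'I_N -> K)
    (u : 'I_n + 'I_m * 'I_N -> K) b :
  (system_row u *m system_mx A Y) 0 b =
  if enum_val b is Some (i, k)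
  then \sum_j A i j * u (inr (j, k)) - u (inl i) * Y i k
  else \sum_(i : 'I_n | i == 0%N :> nat) u (inl i).
Proof.
rewrite !mxE; under eq_bigr do rewrite !mxE.
rewrite -(big_enum_val (fun c => u c * system_coef A Y c (enum_val b))).
rewrite (eq_bigl xpredT) // big_sumType /=; case: (enum_val b) => [[i k]|] /=.
  rewrite addrC; congr (_ + _).
    rewrite (eq_bigr (fun c => u (inr (c.1, c.2)) * (A i c.1 *+ (c.2 == k)))); last by case.
    rewrite -(pair_bigA _ (fun j k' => u (inr (j, k')) * (A i j *+ (k' == k)))) /=.
    apply: eq_bigr => j _; rewrite (bigD1 k) //= eqxx mulr1n big1 ?addr0 1?mulrC //.
    by move=> k' /negPf ->; rewrite mulr0n mulr0.
  rewrite (bigD1 i) //= eqxx mulr1n big1 ?addr0 ?mulrN //.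
  by move=> i' /negPf ->; rewrite mulr0n oppr0 mulr0.
rewrite [X in _ + X]big1 ?addr0 => [|[j k] _]; last by rewrite mulr0.
rewrite [RHS]big_mkcond /=; apply: eq_bigr => i _.
by case: eqP; rewrite ?mulr1 ?mulr0.
Qed.

Lemma system_mx_row_free (K : fieldType) (n m N : nat)
    (A : 'I_n -> 'I_m -> K) (Y : 'I_n -> 'I_N -> K) :
  trivial_kernel A Y -> row_free (system_mx A Y).
Proof.
move=> triv; apply: inj_row_free => v vM.
pose u c := v 0 (enum_rank c).
have vE : v = system_row u.
  by apply/rowP => a; rewrite mxE /u enum_valK.
have eqs b := mul_system_mx A Y u b; rewrite -vE vM in eqs.
have [||nu0 W0] := triv (fun i => u (inl i)) (fun j k => u (inr (j, k))).
- move=> i k; have := eqs (enum_rank (Some (i, k))).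
  by rewrite mxE enum_rankK => /esym /eqP; rewrite subr_eq0 => /eqP.
- move=> i i0; have := eqs (enum_rank None); rewrite mxE enum_rankK.
  rewrite (bigD1 i) ?i0 //= big1 ?addr0 // => i' /andP[/eqP i'0 /eqP]; case.
  by apply/val_inj; rewrite /= i'0.
rewrite vE; apply/rowP => a; rewrite !mxE.
by case: (enum_val a) => [i|[j k]].
Qed.

(** A row vector killed by the system matrix is killed by its product with [B], which is
    invertible. *)
Lemma det_trivial_kernel (K : fieldType) (n m N : nat)
    (A : 'I_n -> 'I_m -> K) (Y : 'I_n -> 'I_N -> K) B :
  \det (system_mx A Y *m B) != 0 -> trivial_kernel A Y.
Proof.
rewrite -unitfE -/(_ \in unitmx) => MBu nu W eqs nu0.
pose u c := match c with inl i => nu i | inr (j, k) => W j k end.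
have uM : system_row u *m system_mx A Y = 0.
  apply/rowP => b; rewrite mul_system_mx mxE.
  case: (enum_val b) => [[i k]|] /=; first by rewrite eqs subrr.
  by rewrite big1 // => i /eqP /nu0.
have u0 : system_row u = 0.
  by rewrite -[LHS](mulmxK MBu) mulmxA uM !mul0mx.
have uc c : u c = 0.
  by have /rowP/(_ (enum_rank c)) := u0; rewrite !mxE enum_rankK.
by split=> [i|j k]; [apply: (uc (inl i))|apply: (uc (inr (j, k)))].
Qed.

(** * A parameter with trivial kernel *)

(* First index of the l-th window; the minimum keeps windows inside [0, m). *)
Definition block_start (m N l : nat) : nat := minn (l * N.-1) (m - N).

Definition special_A (m N i j : nat) : bool :=
  if (i < m)%N then i == j
  else (block_start m N (i - m) <= j < block_start m N (i - m) + N)%N.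

Definition special_X (N j k : nat) : bool := (j %% N == k)%N.

(** [N] consecutive integers have distinct residues modulo [N]. *)
Lemma special_A_inj m N i j j' :
  special_A m N i j -> special_A m N i j' -> (j = j' %[mod N])%N -> j = j'.
Proof.
rewrite /special_A; case: ifP => [_ /eqP <- /eqP <- //|_].
move: (block_start _ _ _) => s /andP[sj jN] /andP[sj' j'N] modj.
wlog le_jj' : j j' sj jN sj' j'N modj / (j <= j')%N.
  by move=> H; case: (leqP j j') => [|/ltnW] le; [apply: H|apply/esym/H].
have /eqP := modj; rewrite eq_sym eqn_mod_dvd // => /dvdn_leq H.
by have := H; lia.
Qed.

Lemma special_A_row m N i : (0 < N <= m)%N -> exists2 j, (j < m)%N & special_A m N i j.
Proof.
move=> /andP[N0 Nm]; rewrite /special_A; case: ltnP => [im|mi]; first by exists i.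
exists (block_start m N (i - m)).
  by rewrite /block_start (leq_ltn_trans (geq_minr _ _)) // ltn_subrL N0; lia.
by rewrite leqnn -[X in (X < _)%N]addn0 ltn_add2l.
Qed.

(** Column [j mod N] of the special [X0] keeps only the indices congruent to [j], and row [i] of the
    special [A] meets just one of them. *)
Lemma special_sum (K : pzRingType) (m N : nat) (N0 : (0 < N)%N) (i : nat)
    (g : 'I_m -> K) (j : 'I_m) :
  special_A m N i j ->
  \sum_(j' < m) (special_A m N i j')%:R * (g j' * (special_X N j' (j %% N))%:R)
    = g j.
Proof.
move=> Aij; rewrite (bigD1 j) //= Aij /special_X eqxx mul1r mulr1 big1 ?addr0 //.
move=> j' /eqP j'j; case A' : (special_A m N i j'); last by rewrite mul0r.
case: eqP => [modj|]; last by rewrite !mulr0.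
by case: j'j; apply/val_inj/(special_A_inj A' Aij modj).
Qed.

Lemma special_trivial_kernel (K : pzRingType) (n m N : nat) :
  (0 < m < n)%N -> (0 < N <= m)%N -> (n.-1 <= N * (n - m))%N ->
  trivial_kernel (fun (i : 'I_n) (j : 'I_m) => (special_A m N i j)%:R : K)
    (fun (i : 'I_n) (k : 'I_N) =>
       \sum_(j < m) (special_A m N i j)%:R * (special_X N j k)%:R).
Proof.
move=> /andP[m0 mn] /andP[N0 Nm] hN nu W eqs nu0.
have lift_m (j : 'I_m) : (j < n)%N := ltn_trans (ltn_ord j) mn.
pose up (j : 'I_m) : 'I_n := Ordinal (lift_m j).
have topA (j j' : 'I_m) : special_A m N (up j) j' = (j == j').
  by rewrite /special_A /= ltn_ord.
(* The identity rows of [A] express [W] through [nu]. *)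
have WE j k : W j k = nu (up j) * (special_X N j k)%:R.
  have pick_j (h : 'I_m -> K) : \sum_(j' < m) (special_A m N (up j) j')%:R * h j' = h j.
    rewrite (bigD1 j) //= topA eqxx mul1r big1 ?addr0 // => j' j'j.
    by rewrite topA eq_sym (negPf j'j) mul0r.
  by have := eqs (up j) k; rewrite !pick_j.
(* In column [j mod N] of row [i] only the term of index [j] survives on each side. *)
have nuE (i : 'I_n) (j : 'I_m) : special_A m N i j -> nu (up j) = nu i.
  move=> Aij; have kN : (j %% N < N)%N by rewrite ltn_mod.
  have := eqs i (Ordinal kN).
  under eq_bigr do rewrite WE.
  rewrite mulr_sumr /= (special_sum N0 (fun j' => nu (up j')) Aij) => ->.
  rewrite -[RHS](special_sum N0 (fun=> nu i) Aij); apply: eq_bigr => j' _.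
  by rewrite -mulr_natl; case: special_A; case: special_X; rewrite ?(mul0r, mulr0, mul1r, mulr1).
pose block (l : nat) (i : 'I_n) := i = (m + l)%N :> nat.
have blockA (i : 'I_n) l (j : 'I_m) : block l i ->
    special_A m N i j = (block_start m N l <= j < block_start m N l + N)%N.
  by move=> il; rewrite /special_A il ltnNge leq_addr /= addKn.
(* The first window contains index 0, where [nu] vanishes, and each later window starts before the
   previous one ends, so vanishing propagates. *)
have prefix l : (l < n - m)%N ->
    forall j : 'I_m, (j < block_start m N l + N)%N -> nu (up j) = 0.
  elim: l => [|l IHl] ln j jl.
    have mi : (m + 0 < n)%N by rewrite addn0.
    pose i := Ordinal mi; pose j0 := Ordinal m0.
    have s0 : block_start m N 0 = 0%N by rewrite /block_start min0n.
    rewrite s0 in jl; rewrite (nuE i j) ?(blockA i 0%N) // ?s0 //.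
    by rewrite -(nuE i j0) ?(blockA i 0%N) // ?s0 // nu0.
  have [jlt|jge] := ltnP j (block_start m N l + N); first by apply: IHl => //; lia.
  have mi : (m + l.+1 < n)%N by lia.
  have sm : (block_start m N l.+1 < m)%N by rewrite /block_start; lia.
  have ss : (block_start m N l.+1 < block_start m N l + N)%N.
    by rewrite /block_start mulSn; lia.
  pose i := Ordinal mi; pose j0 := Ordinal sm.
  rewrite (nuE i j) ?(blockA i l.+1) //; last by apply/andP; split; lia.
  rewrite -(nuE i j0) ?(blockA i l.+1) //; last by rewrite /=; lia.
  by apply: IHl => //; lia.
(* The last window ends at the minimum of [(n - m)(N - 1) + 1] and [m]; by [hN] the former is at
   least [m]. *)
have cover : (m <= block_start m N (n - m).-1 + N)%N.
  have : ((n - m).-1 * N.-1 + N >= m)%N.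
    have -> : ((n - m).-1 * N.-1 + N = (n - m) * N.-1 + 1)%N.
      by rewrite -{2}(prednK (_ : 0 < n - m)%N) ?mulSn; lia.
    by rewrite -subn1 mulnBr muln1 mulnC; lia.
  by rewrite /block_start; lia.
have nu_up j : nu (up j) = 0.
  apply: (prefix (n - m).-1); first by lia.
  exact: leq_trans (ltn_ord j) cover.
split=> [i|j k]; last by rewrite WE nu_up mul0r.
have [|j jm Aij] := @special_A_row m N i; first by rewrite N0.
by rewrite -(nuE i (Ordinal jm)) ?nu_up.
Qed.

(** * From the kernel to identifiability *)

Definition to_complex (z : Defs.C) : R[i] := Complex z.1 z.2.

Lemma to_complex_inj : injective to_complex.
Proof. by move=> [a b] [c d] [-> ->]. Qed.

Lemma to_complex0 : to_complex C0 = 0.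
Proof. by []. Qed.

Lemma to_complexM z w : to_complex (Cmul z w) = to_complex z * to_complex w.
Proof. by []. Qed.

Lemma to_complexV z : to_complex (Cinv z) = (to_complex z)^-1.
Proof. by apply/eqP; rewrite eq_complex /= !expr2 !RmultE !RdivE eqxx /= mulNr. Qed.

Lemma to_complex_sum m (f : nat -> Defs.C) :
  to_complex (Csum m f) = \sum_(j < m) to_complex (f j).
Proof.
by elim: m => [|m IHm]; rewrite ?big_ord0 // big_ord_recr /= -IHm.
Qed.

Lemma to_complex_diagAX m lam A X i k :
  to_complex (diagAX m lam A X i k) = to_complex (lam i) *
    \sum_(j < m) to_complex (A i j) * to_complex (X j k).
Proof. by rewrite to_complexM to_complex_sum. Qed.

(** With [mu = lam0 / lam], one has [A X = diag(mu) Y]. Subtracting [mu_0] times [A X0 = Y] gives a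
    kernel element with [nu = mu - mu_0] and [W = X - mu_0 X0]. Its vanishing makes [mu] constant,
    and [sigma = 1 / mu_0]. *)
Lemma trivial_kernel_identifiable (n m N : nat) (lam0 : nat -> Defs.C)
    (X0 A : nat -> nat -> Defs.C) :
  let Y (i : 'I_n) (k : 'I_N) :=
    \sum_(j < m) to_complex (A i j) * to_complex (X0 j k) in
  (0 < n)%N ->
  (forall i : 'I_n, to_complex (lam0 i) != 0) ->
  (forall i, exists k, Y i k != 0) ->
  trivial_kernel (fun (i : 'I_n) (j : 'I_m) => to_complex (A i j)) Y ->
  identifiable_up_to_scaling n m N lam0 X0 A.
Proof.
move=> Y n0 lam0N Y0 triv lam X eqs.
have eqY (i : 'I_n) (k : 'I_N) : to_complex (lam i) *
    (\sum_(j < m) to_complex (A i j) * to_complex (X j k)) =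
    to_complex (lam0 i) * Y i k.
  by rewrite -!to_complex_diagAX eqs //; apply/ssrnat.ltP.
(* If [lam i] were 0, row [i] of [diag(lam0) Y] would vanish. *)
have lamN (i : 'I_n) : to_complex (lam i) != 0.
  have [k Yk] := Y0 i; apply: contra_neq (mulf_neq0 (lam0N i) Yk) => lam_i.
  by rewrite -eqY lam_i mul0r.
pose mu i := to_complex (lam0 i) / to_complex (lam i).
pose i0 : 'I_n := Ordinal n0.
have [||nu0 W0] := triv (fun i => mu i - mu 0%N)
    (fun j k => to_complex (X j k) - mu 0%N * to_complex (X0 j k)).
- move=> i k; under eq_bigr do rewrite mulrBr mulrCA.
  rewrite sumrB -mulr_sumr -/(Y i k) mulrBl; congr (_ - _).
  by apply: (mulfI (lamN i)); rewrite eqY mulrA /mu [_ * (_ / _)]mulrC divfK.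
- by move=> i i_0; rewrite i_0 subrr.
have [lam_i0 lam0_i0] := (lamN i0, lam0N i0).
exists (Cmul (lam 0%N) (Cinv (lam0 0%N))); split; [|split].
- move=> /(congr1 to_complex); rewrite to_complexM to_complexV => /eqP.
  by rewrite to_complex0 mulf_eq0 invr_eq0 (negPf lam_i0) (negPf lam0_i0).
- move=> i /ssrnat.ltP ltin; apply: to_complex_inj.
  rewrite !to_complexM to_complexV.
  have /eqP := nu0 (Ordinal ltin); rewrite subr_eq0 /mu /= => /eqP mu_i.
  have [lam_i lam0_i] := (lamN (Ordinal ltin), lam0N (Ordinal ltin)).
  by rewrite -invf_div -mu_i invf_div divfK.
- move=> j k /ssrnat.ltP ltjm /ssrnat.ltP ltkN; apply: to_complex_inj.
  rewrite to_complexM to_complexV to_complexM to_complexV invf_div.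
  by have /eqP := W0 (Ordinal ltjm) (Ordinal ltkN); rewrite subr_eq0 => /eqP.
Qed.

(** * Complex-valued polynomial functions of real coordinates *)

Definition complex_poly (I : Type) (f : (I -> R) -> R[i]) : Prop :=
  exists D, polyfun D (fun x => complex.Re (f x)) /\
            polyfun D (fun x => complex.Im (f x)).

Lemma complex_poly_cst (I : Type) c : complex_poly (fun _ : I -> R => c).
Proof. by exists 0%N; split; apply: PolyConst. Qed.

Lemma complex_polyD (I : Type) (f g : (I -> R) -> R[i]) :
  complex_poly f -> complex_poly g -> complex_poly (fun x => f x + g x).
Proof.
move=> [D [fR fI]] [E [gR gI]]; exists (maxn D E); split.
  apply: polyfun_ext (PolyAdd (polyfunW (leq_maxl D E) fR)
    (polyfunW (leq_maxr D E) gR)) => x.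
  by case: (f x) (g x) => [? ?] [? ?].
apply: polyfun_ext (PolyAdd (polyfunW (leq_maxl D E) fI)
  (polyfunW (leq_maxr D E) gI)) => x.
by case: (f x) (g x) => [? ?] [? ?].
Qed.

Lemma complex_polyM (I : Type) (f g : (I -> R) -> R[i]) :
  complex_poly f -> complex_poly g -> complex_poly (fun x => f x * g x).
Proof.
move=> [D [fR fI]] [E [gR gI]]; exists (D + E)%N; split.
  apply: polyfun_ext (PolyAdd (PolyMul fR gR)
    (PolyMul (D := 0) (PolyConst _ _ (-1)) (PolyMul fI gI))) => x.
  by case: (f x) (g x) => [? ?] [? ?] /=; rewrite mulN1r.
apply: polyfun_ext (PolyAdd (PolyMul fR gI) (PolyMul fI gR)) => x.
by case: (f x) (g x) => [? ?] [? ?].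
Qed.

Lemma complex_poly_sum (I J : Type) (r : seq J) (P : pred J)
    (f : J -> (I -> R) -> R[i]) :
  (forall j, complex_poly (f j)) ->
  complex_poly (fun x => \sum_(j <- r | P j) f j x).
Proof.
move=> Pf; elim: r => [|j r IHr].
  rewrite (_ : (fun x => _) = fun=> 0); first exact: complex_poly_cst.
  by apply/funext => x; rewrite big_nil.
rewrite (_ : (fun x => _) = fun x =>
    (if P j then f j x else 0) + \sum_(i <- r | P i) f i x).
  by apply: complex_polyD => //; case: (P j) => //; apply: complex_poly_cst.
by apply/funext => x; rewrite big_cons; case: (P j); rewrite ?add0r.
Qed.

Lemma complex_poly_prod (I J : Type) (r : seq J) (P : pred J)
    (f : J -> (I -> R) -> R[i]) :
  (forall j, complex_poly (f j)) ->
  complex_poly (fun x => \prod_(j <- r | P j) f j x).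
Proof.
move=> Pf; elim: r => [|j r IHr].
  rewrite (_ : (fun x => _) = fun=> 1); first exact: complex_poly_cst.
  by apply/funext => x; rewrite big_nil.
rewrite (_ : (fun x => _) = fun x =>
    (if P j then f j x else 1) * \prod_(i <- r | P i) f i x).
  by apply: complex_polyM => //; case: (P j) => //; apply: complex_poly_cst.
by apply/funext => x; rewrite big_cons; case: (P j); rewrite ?mul1r.
Qed.

Lemma complex_poly_det (I : Type) k (f : (I -> R) -> 'M[R[i]]_k) :
  (forall a b, complex_poly (fun x => f x a b)) ->
  complex_poly (fun x => \det (f x)).
Proof.
move=> Pf; apply: complex_poly_sum => s.
by apply: complex_polyM; [apply: complex_poly_cst|apply: complex_poly_prod].
Qed.

(** The squared modulus of [f] is a real polynomial with the same zeros. *)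
Lemma complex_poly_zeros_null d (f : ('I_d -> R) -> R[i]) :
  (0 < d)%N -> complex_poly f -> (exists x, f x != 0) ->
  lebesgue_null d (fun p => f (fun i => p i) = 0).
Proof.
move=> d0 [D [fR fI]] [x0 fx0].
pose g x := complex.Re (f x) * complex.Re (f x) + complex.Im (f x) * complex.Im (f x).
have g0 x : (g x == 0) = (f x == 0).
  by rewrite paddr_eq0 -?expr2 ?sqr_ge0 // !sqrf_eq0 eq_complex.
have Pg : polyfun (D + D) g by apply: PolyAdd; apply: PolyMul.
have gx0 : exists x, g x != 0 by exists x0; rewrite g0.
have := polyfun_zeros_null d0 Pg gx0; congr lebesgue_null.
apply/funext => p; apply/propext; split=> /eqP; first by rewrite g0 => /eqP.
by rewrite -g0 => /eqP.
Qed.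

(** * The parameter space *)

Lemma coordC_extend d (p : nat -> R) o : (o.*2.+1 < d)%N ->
  coordC (extend (fun i : 'I_d => p i)) o = coordC p o.
Proof.
move=> od; have pE j : (j < d)%N -> extend (fun i : 'I_d => p i) j = p j.
  by move=> jd; rewrite (extendE _ (Ordinal jd)).
by rewrite /coordC !pE // ?multE ?plusE mul2n ?addn1 // ltnW.
Qed.

Lemma complex_poly_coord d o :
  complex_poly (fun x : 'I_d -> R => to_complex (coordC (extend x) o)).
Proof.
have extend_poly j : polyfun 1 (fun x : 'I_d -> R => extend x j).
  by rewrite /extend; case: insubP => *; [apply: PolyCoord|apply: PolyConst].
by exists 1%N; split; apply: extend_poly.
Qed.

Lemma param_dimE n m N : param_dim n m N = (n + (m * N + n * m)).*2.
Proof. by rewrite /param_dim !multE !plusE -addnA mul2n. Qed.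

Lemma dec_lam_extend n m N (p : nat -> R) i : (i < n)%N ->
  dec_lam (extend (fun c : 'I_(param_dim n m N) => p c)) i = dec_lam p i.
Proof. by move=> ltin; rewrite /dec_lam coordC_extend // param_dimE; lia. Qed.

Lemma dec_X_extend n m N (p : nat -> R) j k : (j < m)%N -> (k < N)%N ->
  dec_X n N (extend (fun c : 'I_(param_dim n m N) => p c)) j k = dec_X n N p j k.
Proof.
move=> ltjm ltkN; rewrite /dec_X coordC_extend // param_dimE !multE !plusE.
have : (j * N + k < m * N)%N.
  by apply: leq_trans (leq_mul ltjm (leqnn N)); rewrite mulSn addnC ltn_add2r.
lia.
Qed.

Lemma dec_A_extend n m N (p : nat -> R) i j : (i < n)%N -> (j < m)%N ->
  dec_A n m N (extend (fun c : 'I_(param_dim n m N) => p c)) i j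
    = dec_A n m N p i j.
Proof.
move=> ltin ltjm; rewrite /dec_A coordC_extend // param_dimE !multE !plusE.
have : (i * m + j < n * m)%N.
  by apply: leq_trans (leq_mul ltin (leqnn m)); rewrite mulSn addnC ltn_add2r.
lia.
Qed.

(** Inverts the layout of the decoders: odd coordinates are imaginary parts, [o] numbers the complex
    coordinates, and quotient and remainder recover row and column. *)
Definition special_param (n m N : nat) (c : nat) : R :=
  let o := c./2 in
  if odd c then 0
  else if (o < n)%N then 1
  else if (o < n + m * N)%N
    then (special_X N ((o - n) %/ N) ((o - n) %% N))%:R
  else (special_A m N ((o - (n + m * N)) %/ m) ((o - (n + m * N)) %% m))%:R.

Lemma coordC_special n m N o :
  to_complex (coordC (special_param n m N) o) =
  Complex (special_param n m N o.*2) 0.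
Proof.
rewrite /coordC !multE plusE mul2n addn1; congr Complex.
by rewrite /special_param /= odd_double.
Qed.

Lemma complex_nat_bool (b : bool) : Complex (b%:R : R) 0 = b%:R.
Proof. by case: b. Qed.

Lemma special_lam n m N i : (i < n)%N ->
  to_complex (dec_lam (special_param n m N) i) = 1.
Proof.
by move=> ltin; rewrite coordC_special /special_param odd_double doubleK ltin.
Qed.

Lemma special_XE n m N j k : (j < m)%N -> (k < N)%N ->
  to_complex (dec_X n N (special_param n m N) j k) = (special_X N j k)%:R.
Proof.
move=> ltjm ltkN; rewrite /dec_X !multE !plusE coordC_special /special_param.
rewrite odd_double doubleK ltnNge leq_addr /= ltn_add2l ifT.
  rewrite addKn divnMDl ?(leq_ltn_trans _ ltkN) // divn_small // addn0.
  by rewrite modnMDl modn_small // complex_nat_bool.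
by apply: leq_trans (leq_mul ltjm (leqnn N)); rewrite mulSn addnC ltn_add2r.
Qed.

Lemma special_AE n m N i j : (j < m)%N ->
  to_complex (dec_A n m N (special_param n m N) i j) = (special_A m N i j)%:R.
Proof.
move=> ltjm; rewrite /dec_A !multE !plusE coordC_special /special_param.
rewrite odd_double doubleK ltnNge -addnA leq_addr /= addnA ltnNge leq_addr /=.
rewrite addKn divnMDl ?(leq_ltn_trans _ ltjm) // divn_small // addn0.
by rewrite modnMDl modn_small // complex_nat_bool.
Qed.

Lemma almost_all_identifiable (n m N : nat) :
  (0 < m < n)%N -> (0 < N <= m)%N -> (n.-1 <= N * (n - m))%N ->
  almost_all_params n m N
    (fun lam0 X0 A => identifiable_up_to_scaling n m N lam0 X0 A).
Proof.
move=> mn Nm hN; have [[/andP[m0 ltmn] N0]] := (mn, (andP Nm).1).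
have n0 : (0 < n)%N by apply: leq_ltn_trans ltmn.
set d := param_dim n m N.
pose restrict (p : nat -> R) : 'I_d -> R := fun i => p i.
pose lam (x : 'I_d -> R) (i : 'I_n) := to_complex (dec_lam (extend x) i).
pose X (x : 'I_d -> R) (j : 'I_m) (k : 'I_N) :=
  to_complex (dec_X n N (extend x) j k).
pose A (x : 'I_d -> R) (i : 'I_n) (j : 'I_m) :=
  to_complex (dec_A n m N (extend x) i j).
pose Y x (i : 'I_n) (k : 'I_N) := \sum_j A x i j * X x j k.
pose x0 := restrict (special_param n m N).
have lam_x0 i : lam x0 i = 1 by rewrite /lam dec_lam_extend ?special_lam.
have A_x0 : A x0 = fun i j => (special_A m N i j)%:R.
  by apply/funext => i; apply/funext => j; rewrite /A dec_A_extend ?special_AE.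
have X_x0 : X x0 = fun j k => (special_X N j k)%:R.
  by apply/funext => j; apply/funext => k; rewrite /X dec_X_extend ?special_XE.
(* Fixing one nonzero entry per row of [A X0] turns the nonvanishing of the rows into that of a
   product of polynomials. *)
have /choice[kappa Y_x0] : forall i, exists k, Y x0 i k = 1.
  move=> i; have [j jm Aij] := special_A_row i Nm.
  have kN : (j %% N < N)%N by rewrite ltn_mod.
  exists (Ordinal kN); rewrite /Y A_x0 X_x0.
  rewrite -[RHS](special_sum N0 (fun=> 1) (j := Ordinal jm) Aij).
  by apply: eq_bigr => j' _; rewrite mul1r.
have triv0 : trivial_kernel (A x0) (Y x0).
  by rewrite /Y A_x0 X_x0; apply: special_trivial_kernel.
(* Unknowns form row vectors, so the left inverse of the system multiplies on the right. It is taken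
   at [x0] and stays constant, which keeps [G] polynomial. *)
pose B := pinvmx (system_mx (A x0) (Y x0)).
pose G x := \det (system_mx (A x) (Y x) *m B) *
  ((\prod_i lam x i) * \prod_i Y x i (kappa i)).
have PA i j : complex_poly (fun x => A x i j) by apply: complex_poly_coord.
have PY i k : complex_poly (fun x => Y x i k).
  apply: complex_poly_sum => j; apply: complex_polyM => //.
  exact: complex_poly_coord.
have PG : complex_poly G.
  apply: complex_polyM.
    apply: complex_poly_det => a b.
    rewrite (_ : (fun x => _) =
      fun x => \sum_c system_coef (A x) (Y x) (enum_val a) (enum_val c) * B c b).
      apply: complex_poly_sum => c.
      apply: complex_polyM; last exact: complex_poly_cst.
      case: (enum_val a) (enum_val c) => [i'|[j k']] [[i k]|] /=;
        try exact: complex_poly_cst.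
        case: eqP => _; last exact: complex_poly_cst.
        rewrite (_ : (fun x => _) = fun x => -1 * Y x i k).
          by apply: complex_polyM => //; apply: complex_poly_cst.
        by apply/funext => x; rewrite mulN1r.
      by case: eqP => _; [apply: PA|apply: complex_poly_cst].
    by apply/funext => x; rewrite mxE; apply: eq_bigr => c _; rewrite mxE.
  by apply: complex_polyM; apply: complex_poly_prod => i //;
    apply: complex_poly_coord.
have G_x0 : G x0 != 0.
  rewrite /G mulmxVp ?det1 ?system_mx_row_free // mul1r.
  by rewrite !big1 ?mulr1 ?oner_neq0.
exists (fun p => G (restrict p) = 0); split.
  apply: complex_poly_zeros_null => //; last by exists x0.
  by rewrite /d param_dimE; lia.
move=> p /eqP; rewrite !mulf_eq0 !negb_or => /andP[detN /andP[lamN YN]].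
have AE : (fun (i : 'I_n) (j : 'I_m) => to_complex (dec_A n m N p i j))
    = A (restrict p).
  by apply/funext => i; apply/funext => j; rewrite /A dec_A_extend.
have YE : (fun (i : 'I_n) (k : 'I_N) =>
    \sum_(j < m) to_complex (dec_A n m N p i j) * to_complex (dec_X n N p j k))
    = Y (restrict p).
  apply/funext => i; apply/funext => k; apply: eq_bigr => j _.
  by rewrite /A /X dec_A_extend // dec_X_extend.
apply: trivial_kernel_identifiable => //.
- move=> i; have /prodf_neq0/(_ i isT) := lamN.
  by rewrite /lam dec_lam_extend.
- move=> i; exists (kappa i); have /prodf_neq0/(_ i isT) := YN.
  by rewrite -YE.
by rewrite YE AE; apply: det_trivial_kernel detN.
Qed.

Lemma almost_all_identifiable_stdlib (n m N : nat) :
  lt 0 m -> lt 0 N -> lt m n ->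
  Rle (Rdiv (Rminus (INR n) 1) (Rminus (INR n) (INR m))) (INR N) -> le N m ->
  almost_all_params n m N
    (fun lam0 X0 A => identifiable_up_to_scaling n m N lam0 X0 A).
Proof.
move=> /ssrnat.ltP m0 /ssrnat.ltP N0 /ssrnat.ltP mn + /ssrnat.leP Nm.
rewrite !INRE !RdivE !RminusE R1E => /RleP hN.
apply: almost_all_identifiable; rewrite ?m0 ?N0 //.
have n0 : (0 < n)%N by apply: leq_ltn_trans mn.
(* As [m < n], both differences are natural numbers and the denominator can be cleared. *)
move: hN; rewrite -(natrB _ (ltnW mn)) -(natrB _ n0) subn1.
rewrite ler_pdivrMr; last by rewrite ltr0n subn_gt0.
by rewrite -natrM ler_nat.
Qed.

End Identifiability.

Theorem theorem1 (n m N : nat)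
  (Hm : (0 < m)%nat) (HN : (0 < N)%nat) (Hnm : (m < n)%nat)
  (HN1 : (INR n - 1) / (INR n - INR m) <= INR N) (HN2 : (N <= m)%nat) :
  almost_all_params n m N
    (fun lam0 X0 A => identifiable_up_to_scaling n m N lam0 X0 A).
Proof.
exact (Identifiability.almost_all_identifiable_stdlib Hm HN Hnm HN1 HN2).
Qed.
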